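(* Let $\{\theta_i^0\}_{i=1}^N\in\mathbb{R}^N$ satisfy $\theta_i^0\in(-\pi,\pi)$ for every $i\in\{1,\dots,N\}$, and let $\varepsilon>0$. Then there exist positive numbers $a,b,c$, depending only on $\max_i|\theta_i^0|$ and $\varepsilon$ (in particular not otherwise on $N$ or on $\{\theta_i^0\}$), such that if the initial velocities $\{\omega_i^0\}_{i=1}^N\in\mathbb{R}^N$ and the system parameters $\{\nu_i\}_{i=1}^N\in\mathbb{R}^N$, $\kappa>0$, $m>0$ satisfy $$\frac{\max_i|\nu_i|}{\kappa}<a,\qquad m\kappa<b,\qquad \frac{\max_i|\omega_i^0|}{\kappa}<c,$$ then oscillator death occurs for the solution $\Theta(t)=(\theta_1(t),\dots,\theta_N(t))$ of the inertial Winfree system with these parameters and initial data, and $$\lim_{t\to\infty}R(t)>2-\varepsilon .$$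
   Context: The inertial (second-order) Winfree system with $N\ge1$ oscillators, inertia $m>0$, coupling strength $\kappa$, and natural frequencies $\nu_i\in\mathbb{R}$ is the Cauchy problem for real-valued functions $\theta_i(t)$, $i=1,\dots,N$: $$m\ddot\theta_i+\dot\theta_i=\nu_i-\frac{\kappa}{N}\sum_{j=1}^N(1+\cos\theta_j(t))\sin\theta_i(t)\quad(t>0),\qquad (\theta_i,\dot\theta_i)(0)=(\theta_i^0,\omega_i^0).$$ It has a unique global solution on $[0,\infty)$. The order parameter is $R(t)=\frac1N\sum_{j=1}^N(1+\cos\theta_j(t))\in[0,2]$. Oscillator death means that for every $i$ the limit $\lim_{t\to\infty}\theta_i(t)$ exists in $\mathbb{R}$ and $\lim_{t\to\infty}\dot\theta_i(t)=0$. *)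

(* Defs.v *)
From mathcomp Require Import all_boot all_order all_algebra.
From mathcomp Require Import all_classical all_reals all_analysis.

Set Implicit Arguments.
Unset Strict Implicit.
Unset Printing Implicit Defensive.

Import Order.TTheory GRing.Theory Num.Theory.
Import numFieldNormedType.Exports.

Local Open Scope ring_scope.
Local Open Scope classical_set_scope.


(* The default value 0 is harmless: all the terms are nonnegative. *)
Definition max_abs (R : realType) (N : nat) (x : 'I_N -> R) : R :=
  \big[Num.max/0]_(i < N) `|x i|.

Definition order_parameter (R : realType) (N : nat)
    (theta : 'I_N -> R -> R) (t : R) : R :=
  N%:R^-1 * \sum_(j < N) (1 + cos (theta j t)).

(* Classical solutions on [0, +oo[, of class C^1 up to t = 0 and twice
   differentiable for t > 0.  The values of [theta i] at negative times are
   irrelevant, so the initial velocity is the right derivative at 0, and the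
   velocity is right-continuous there. *)
Definition winfree_solution (R : realType) (N : nat) (m kappa : R)
    (nu theta0 omega0 : 'I_N -> R) (theta : 'I_N -> R -> R) : Prop :=
  forall i : 'I_N,
    [/\ theta i 0 = theta0 i,
        h^-1 * (theta i h - theta i 0) @[h --> 0^'+] --> omega0 i,
        (theta i)^`() t @[t --> 0^'+] --> omega0 i &
        forall t : R, 0 < t ->
          [/\ derivable (theta i) t 1,
              derivable (theta i)^`() t 1 &
              m * derive1n 2 (theta i) t + derive1 (theta i) t =
                nu i - kappa / N%:R *
                  \sum_(j < N) (1 + cos (theta j t)) * sin (theta i t)]].

Definition oscillator_death (R : realType) (N : nat)
    (theta : 'I_N -> R -> R) : Prop :=
  forall i : 'I_N,
    (exists l : R, theta i t @[t --> +oo] --> l) /\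
    (theta i)^`() t @[t --> +oo] --> (0 : R).

(* Main.v *)
(** The phases phi_i = theta_i + m theta_i' satisfy the first-order equations
    phi_i' = nu_i - kappa R sin theta_i, and |theta_i'| < 3 kappa, so that
    |phi_i - theta_i| <= 3 m kappa.  For small m kappa and small |nu_i| / kappa
    the flow points inwards on the boundary of the cube max_i |phi_i| <= B as
    long as B stays away from 0 and pi: the phases are trapped away from +-pi,
    which bounds R from below, and they then decrease at a definite rate until
    all the theta_i are close to 0, whence R > 2 - eps.

    Near 0, put p_i = phi_i' and q_i = m theta_i'', so that theta_i' = p_i - q_i
    and p' = - H (p - q) for a symmetric matrix H with kappa <= H <= 2 kappa.
    In the derivative of E = sum_i (p_i^2 + q_i^2) the cross terms cancel by
    symmetry of H, leaving E' = -2 pHp + 2 qHq - (2/m) |q|^2 <= -2 kappa E.  So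
    the velocities decay exponentially and the theta_i converge. *)

Require Import Defs.
From mathcomp Require Import all_boot all_order all_algebra.
From mathcomp Require Import all_classical all_reals all_analysis.
From mathcomp Require Import ring lra.

Set Implicit Arguments.
Unset Strict Implicit.
Unset Printing Implicit Defensive.

Import Order.TTheory GRing.Theory Num.Theory.
Import numFieldNormedType.Exports.

Local Open Scope ring_scope.
Local Open Scope classical_set_scope.

(** * Barrier, decay and convergence arguments for functions on a half-line *)

Section real_functions.
Variable R : realType.
Implicit Types (f df : R -> R) (a t B : R).

Lemma is_derive_continuous f t d : is_derive t 1 f d -> {for t, continuous f}.
Proof. by move=> fd; apply/differentiable_continuous/derivable1_diffP. Qed.

Lemma is_derive_sqr f t d :
  is_derive t 1 f d -> is_derive t 1 (f ^+ 2) (2 * (f t * d)).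
Proof.
move=> fd; apply: is_derive_eq.
by rewrite expr1 [LHS]/GRing.scale/= mulrA.
Qed.

Lemma mvt_ray f df a x y : (forall t, a <= t -> is_derive t 1 f (df t)) ->
  a <= x -> x <= y -> exists2 c, a <= c & f y - f x = df c * (y - x).
Proof.
move=> fdf ax xy.
have [c||c] := @MVT_segment R f df x y xy.
- by rewrite in_itv/= => /andP[xc _]; apply: fdf; rewrite (le_trans ax)// ltW.
- apply: derivable_within_continuous => c; rewrite in_itv/= => /andP[xc _].
  by have [] := fdf c (le_trans ax xc).
- by rewrite in_itv/= => /andP[xc _] ->; exists c => //; exact: le_trans xc.
Qed.

Lemma is_derive_le0_decr f df a :
  (forall t, a <= t -> is_derive t 1 f (df t)) ->
  (forall t, a <= t -> df t <= 0) ->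
  forall x y, a <= x -> x <= y -> f y <= f x.
Proof.
move=> fdf df0 x y ax xy; have [c ac e] := mvt_ray fdf ax xy.
by rewrite -subr_le0 e mulr_le0_ge0 ?df0// subr_ge0.
Qed.

Lemma derive_lt0_left f t d : is_derive t 1 f d -> d < 0 ->
  \forall s \near t^'-, f t < f s.
Proof.
move=> [fd fdE] d0.
have : h^-1 *: (f (h *: 1 + t) - f t) @[h --> 0^'] --> d by rewrite -fdE; exact: fd.
move=> /cvgr_lt /(_ _ d0); rewrite /prop_near1 /within/= => -[e /= e0 He].
near=> s.
have st : s < t by near: s; exact: nbhs_left_lt.
have : (s - t)^-1 *: (f ((s - t) *: 1 + t) - f t) < 0.
  apply: (He (s - t)); last by rewrite subr_eq0 lt_eqF.
  rewrite /= sub0r normrN ltr0_norm ?subr_lt0// opprB ltrBlDr -ltrBlDl.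
  by near: s; apply: nbhs_left_gt; rewrite gtrBl.
by rewrite [_ *: 1]mulr1 subrK [_ *: _]mulrC nmulr_llt0 ?invr_lt0 ?subr_lt0// subr_gt0.
Unshelve. all: by end_near. Qed.

(** At the first time some component reaches [B], all components are at most [B], so the one that
    has reached it has negative derivative and was above [B] just before: a contradiction. The sign
    condition may use the bound on all components, which is what a coupled system provides. *)
Lemma barrier (I : finType) (g dg : I -> R -> R) a B :
  (forall k t, a <= t -> is_derive t 1 (g k) (dg k t)) ->
  (forall k, g k a < B) ->
  (forall k t, a <= t -> (forall j, g j t <= B) -> g k t = B -> dg k t < 0) ->
  forall k t, a <= t -> g k t < B.
Proof.
move=> gdg ga dgB k0 t0 at0; rewrite ltNge; apply/negP => Bt0.
pose S := [set t | a <= t /\ exists k, B <= g k t].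
have lbS : lbound S a by move=> t [].
have S0 : S !=set0 by exists t0; split=> //; exists k0.
have infS : has_inf S by split=> //; exists a.
have aT : a <= inf S by apply: lb_le_inf.
have beforeT k t : a <= t -> t < inf S -> g k t < B.
  move=> at_ tT; rewrite ltNge; apply/negP => Bt.
  have : inf S <= t by apply: inf_lbound; [exists a|split=> //; exists k].
  by rewrite leNgt tT.
have cg k : {for inf S, continuous (g k)} by apply: is_derive_continuous (gdg k _ aT).
(* Otherwise continuity of the finitely many components keeps all of them below [B] on a
   neighbourhood of [inf S], although [S] has points arbitrarily close to its infimum. *)
have [k Bk] : exists k, B <= g k (inf S).
  apply: contrapT => /forallNP noB.
  have near_lt k : \forall t \near inf S, g k t < B.
    by apply: (cvgr_lt _ (cg k)); rewrite ltNge; apply/negP.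
  have [e /= e0 He] := filter_forall _ near_lt.
  have [s [as_ [k Bs]]] := inf_adherent e0 infS.
  move=> sT; have Ts : inf S <= s by apply: inf_lbound; [exists a|split=> //; exists k].
  have : g k s < B by apply: He; rewrite /= distrC ger0_norm ?subr_ge0// ltrBlDl.
  by rewrite ltNge Bs.
have altT : a < inf S.
  by rewrite lt_neqAle aT andbT; apply/eqP => aE; have := ga k; rewrite aE ltNge Bk.
have gT j : g j (inf S) <= B.
  apply: (@cvgr_to_le _ (inf S)^'- _ _ (g j)).
    by apply: cvg_at_left_filter; exact: cg.
  near=> s; apply/ltW/beforeT; near: s; last exact: nbhs_left_lt.
  exact: nbhs_left_ge.
have gkT : g k (inf S) = B by apply/eqP; rewrite eq_le gT Bk.
have : \forall s \near (inf S)^'-, False.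
  near=> s.
  have sT : s < inf S by near: s; exact: nbhs_left_lt.
  have as_ : a <= s by near: s; exact: nbhs_left_ge.
  have : g k (inf S) < g k s.
    by near: s; apply: derive_lt0_left (gdg k _ aT) (dgB k _ aT gT gkT).
  by rewrite gkT ltNge => /negP; apply; exact/ltW/beforeT.
by move/filter_ex => [].
Unshelve. all: by end_near. Qed.

(** Passing to squares avoids differentiating the absolute value at 0. *)
Lemma barrier_norm (I : finType) (x dx : I -> R -> R) a B : 0 <= B ->
  (forall k t, a <= t -> is_derive t 1 (x k) (dx k t)) ->
  (forall k, `|x k a| < B) ->
  (forall k t, a <= t -> (forall j, `|x j t| <= B) -> `|x k t| = B ->
    x k t * dx k t < 0) ->
  forall k t, a <= t -> `|x k t| < B.
Proof.
move=> B0 xdx xa dxB k t at_.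
have norm_sqr y : (y ^+ 2 < B ^+ 2) = (`|y| < B).
  by rewrite -(real_normK (num_real y)) ltr_pXn2r ?nnegrE.
have norm_sqr_le y : (y ^+ 2 <= B ^+ 2) = (`|y| <= B).
  by rewrite -(real_normK (num_real y)) ler_pXn2r ?nnegrE.
rewrite -norm_sqr.
apply: (@barrier I (fun k => x k ^+ 2) (fun k t => 2 * (x k t * dx k t)) a) => //.
- by move=> j s /xdx xd; exact: is_derive_sqr (xd j).
- by move=> j; rewrite /= norm_sqr.
- move=> j s as_ xB xjB; rewrite pmulr_rlt0//; apply: dxB => // [i|].
    by rewrite -norm_sqr_le; exact: xB.
  apply/eqP; rewrite -(eqrXn2 (n := 2))// real_normK ?num_real//.
  by apply/eqP; exact: xjB.
Qed.

Lemma decay_below g dg a B r : 0 < r ->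
  (forall t, a <= t -> is_derive t 1 g (dg t)) ->
  (forall t, a <= t -> B <= g t -> dg t <= - r) ->
  exists2 t, a <= t & g t < B.
Proof.
move=> r0 gdg dgr; apply: contrapT => noB.
have gB t : a <= t -> B <= g t.
  by move=> at_; rewrite leNgt; apply/negP => gt; apply: noB; exists t.
have gaB := gB a (lexx _).
(* Over this length a slope of at most [- r] produces a drop of at least [g a - B + r], which is
   more than the available [g a - B]. *)
have ab : a <= a + ((g a - B) / r + 1).
  by rewrite lerDl addr_ge0// divr_ge0 ?subr_ge0// ltW.
have [c ac] := mvt_ray gdg (lexx a) ab.
have := gB _ ab; have := dgr _ ac (gB _ ac).
set b := a + _ => dc gb; rewrite {2}/b (addrC a) addrK => e.
have : dg c * ((g a - B) / r + 1) <= - r * ((g a - B) / r + 1).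
  by rewrite ler_wpM2r// addr_ge0// divr_ge0 ?subr_ge0// ltW.
have : (g a - B) / r * r = g a - B by rewrite divfK ?gt_eqF.
move: e; set q := (g a - B) / r => e qr; rewrite -e; nra.
Qed.

(** With [E] the integral of the bound from [t] to infinity, [f - E] is nondecreasing and [f + E] is
    nonincreasing. Hence [f - E] is bounded above and converges, and [E] tends to 0. *)
Lemma cvg_of_expR_derive f df (k C a : R) : 0 < k ->
  (forall t, a <= t -> is_derive t 1 f (df t)) ->
  (forall t, a <= t -> `|df t| <= C * expR (- (k * t))) ->
  (exists l : R, f t @[t --> +oo] --> l) /\ df t @[t --> +oo] --> (0 : R).
Proof.
move=> k0 fdf dfC.
have Cexpk (c : R) : (fun t : R => c * expR (- (k * t))) @ +oo --> (0 : R).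
  rewrite -(mulr0 c); apply: cvgM; first exact: cvg_cst.
  apply: (@cvg_comp _ _ _ (fun t => k * t) (fun t => expR (- t)) _ (pinfty_nbhs R)).
    exact: gt0_cvgMry.
  exact: cvgr_expR.
split; last first.
  apply/norm_cvg0P.
  apply: (@squeeze_cvgr _ _ _ _ (cst 0) (fun t => C * expR (- (k * t)))) => //;
    last exact: cvg_cst.
  near=> t; rewrite normr_ge0/=; apply: dfC.
  by near: t; apply: nbhs_pinfty_ge; rewrite num_real.
pose E t := C / k * expR (- (k * t)).
have dE t : is_derive t 1 E (- (C * expR (- (k * t)))).
  apply: is_derive_eq.
  rewrite -![_ *: _]/(_ * _) mulr1; field; lra.
have C0 : 0 <= C.
  have := le_trans (normr_ge0 _) (dfC a (lexx a)).
  by rewrite pmulr_lge0 ?expR_gt0.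
have E0 t : 0 <= E t by rewrite mulr_ge0 ?expR_ge0// divr_ge0// ltW.
have incr x y : a <= x -> x <= y -> f x - E x <= f y - E y.
  move=> ax xy; have : E y - f y <= E x - f x.
    apply: (@is_derive_le0_decr (E - f)
      (fun t => - (C * expR (- (k * t))) - df t) a) => // [t at_|t at_].
      by have ? := fdf t at_; apply: is_deriveB.
    by have := dfC t at_; rewrite ler_norml => /andP[+ _]; lra.
  by lra.
have decr x y : a <= x -> x <= y -> f y + E y <= f x + E x.
  apply: (@is_derive_le0_decr (f + E)
    (fun t => df t - (C * expR (- (k * t)))) a) => // [t at_|t at_].
    by have ? := fdf t at_; apply: is_deriveD.
  by have := dfC t at_; rewrite ler_norml => /andP[_ +]; lra.
(* Freezing [f - E] to the left of [a] makes it monotone on the whole line, as the monotone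
   convergence lemma requires. *)
pose G t := f (Num.max a t) - E (Num.max a t).
have Gcvg : G t @[t --> +oo] --> sup (range G).
  apply: nondecreasing_cvgr => [x y xy|].
    by apply: incr; [rewrite le_max lexx|rewrite ge_max !le_max lexx xy orbT].
  exists (f a + E a) => _ [t _ <-].
  have := @decr a (Num.max a t) (lexx a); rewrite le_max lexx => /(_ isT).
  by have := E0 (Num.max a t); rewrite /G; lra.
exists (sup (range G)).
have : (G t + E t) @[t --> +oo] --> sup (range G) + 0.
  by apply: cvgD => //; exact: Cexpk.
rewrite addr0; apply: cvg_trans; apply: near_eq_cvg; near=> t.
have at_ : a <= t by near: t; apply: nbhs_pinfty_ge; rewrite num_real.
by rewrite /G max_r// subrK.
Unshelve. all: by end_near. Qed.

End real_functions.

(** * Bounds on sine and cosine away from the multiples of pi and near 0 *)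

Section trigonometry.
Variable R : realType.
Implicit Types x y : R.

(** Meant for [x] a phase and [y] the angle at distance at most [e] from it: the coupling pulls the
    phase towards 0 at a definite rate. Since sine is odd, negative [x] reduces to positive [x]. *)
Lemma mul_sin_ge (lo hi e s x y : R) : 0 <= lo -> 0 <= e ->
  (forall z, lo <= z <= hi -> s <= sin z) ->
  lo + e <= `|x| <= hi - e -> `|y - x| <= e -> `|x| * s <= x * sin y.
Proof.
move=> lo0 e0 sinz; rewrite [_ <= e]ler_norml.
have [x0|x0] := ger0P x => /andP[xlo xhi] /andP[yx1 yx2].
  by rewrite ler_wpM2l// sinz//; apply/andP; split; lra.
rewrite -[x * _]mulrNN -sinN ler_wpM2l//; first by rewrite oppr_ge0 ltW.
by rewrite sinz//; apply/andP; split; lra.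
Qed.

Lemma sin_itv_lower_bound (a b : R) : 0 < a -> a <= b -> b < pi ->
  exists2 s, 0 < s & forall x, a <= x <= b -> s <= sin x.
Proof.
move=> a0 ab bpi.
have [c cab minc] := @EVT_min R sin a b ab (continuous_subspaceT (@continuous_sin R)).
exists (sin c); last by move=> x xab; apply: minc; rewrite in_itv.
move: cab; rewrite in_itv/= => /andP[ac cb]; apply: sin_gt0_pi.
by rewrite (lt_le_trans a0)//= (le_lt_trans cb).
Qed.

Lemma cos_norm x : cos `|x| = cos x.
Proof. by have [//|_] := ger0P x; rewrite cosN. Qed.

Lemma cos_lower_bound (b : R) : b < pi ->
  exists2 r, 0 < r & forall x, `|x| <= b -> r <= 1 + cos x.
Proof.
move=> bpi; have [b0|b0] := ltP b 0.
  by exists 1 => // x xb; have := le_lt_trans xb b0; rewrite normr_lt0.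
have bI : b \in `[0, pi]%R by rewrite in_itv/= b0 ltW.
exists (1 + cos b).
  rewrite -ltrBlDl sub0r -cospi ltr_cos//; by rewrite in_itv/= lexx pi_ge0.
move=> x xb; rewrite lerD2l -(cos_norm x) leNgt ltr_cos// -?leNgt//.
by rewrite in_itv/= normr_ge0 (le_trans xb)// ltW.
Qed.

Lemma cos_near0 (eta : R) : 0 < eta ->
  exists2 delta, 0 < delta & forall x, `|x| <= delta -> 1 - eta <= cos x.
Proof.
move=> eta0; have cvg1 : cos x @[x --> (0 : R)] --> (1 : R) by rewrite -cos0; exact: continuous_cos.
have [|e /= e0 He] := cvgr_gt _ cvg1 (1 - eta); first by rewrite gtrBl.
exists (e / 2) => [|x xe]; first by rewrite divr_gt0.
apply/ltW/He; rewrite /= sub0r normrN (le_lt_trans xe)// ltr_pdivrMr//; lra.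
Qed.

End trigonometry.

(** * The Cauchy-Schwarz inequality against the constant vector *)

Section quadratic_sums.
Variables (R : realFieldType) (N : nat).
Implicit Types x : 'I_N -> R.

Lemma sqr_sum_le x : (\sum_i x i) ^+ 2 <= N%:R * \sum_i x i ^+ 2.
Proof.
case: N x => [|n] x; first by rewrite big_ord0 mul0r expr0n.
set S := \sum_i x i; set Q := \sum_i x i ^+ 2.
have n0 : (0 : R) < n.+1%:R by rewrite ltr0n.
(* The variance, cleared of denominators. *)
have : 0 <= \sum_i (n.+1%:R * x i - S) ^+ 2 by apply: sumr_ge0 => i _; exact: sqr_ge0.
have -> : \sum_i (n.+1%:R * x i - S) ^+ 2 = n.+1%:R * (n.+1%:R * Q - S ^+ 2).
  rewrite (eq_bigr (fun i => n.+1%:R ^+ 2 * x i ^+ 2 - (2 * n.+1%:R * S) * x i + S ^+ 2)).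
    rewrite big_split big_split/= sumrN -!mulr_sumr sumr_const card_ord -/Q -/S.
    by rewrite -mulr_natl; ring.
  by move=> i _; ring.
by rewrite pmulr_rge0// subr_ge0.
Qed.

End quadratic_sums.

(** * The flow at positive times: velocity bound, trapping of the phases, decay of the velocities *)

Definition phase (R : realType) (N : nat) (m : R) (theta v : 'I_N -> R -> R)
    (i : 'I_N) (t : R) : R :=
  theta i t + m * v i t.

Definition winfree_flow (R : realType) (N : nat) (m kappa : R) (nu : 'I_N -> R)
    (theta v dv : 'I_N -> R -> R) : Prop :=
  forall (i : 'I_N) (t : R), 0 < t ->
    [/\ is_derive t 1 (theta i) (v i t), is_derive t 1 (v i) (dv i t) &
        m * dv i t + v i t =
          nu i - kappa * order_parameter theta t * sin (theta i t)].

Lemma winfree_solution_flow (R : realType) (N : nat) (m kappa : R)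
    (nu theta0 omega0 : 'I_N -> R) (theta : 'I_N -> R -> R) :
  winfree_solution m kappa nu theta0 omega0 theta ->
  winfree_flow m kappa nu theta (fun i => (theta i)^`())
    (fun i => derive1n 2 (theta i)).
Proof.
move=> sol i t t0; have [_ _ _ /(_ t t0)[dth dv eqv]] := sol i.
split.
- exact: DeriveDef dth (esym (derive1E _ _)).
- exact: DeriveDef dv (esym (derive1E _ _)).
- by rewrite eqv /order_parameter mulrA -mulr_suml mulrA.
Qed.

Section flow.
Variables (R : realType) (N : nat) (m kappa : R) (nu : 'I_N -> R).
Variables (theta v dv : 'I_N -> R -> R).
Implicit Types (i j : 'I_N) (t : R).
Hypotheses (N0 : (0 < N)%N) (m0 : 0 < m) (kappa0 : 0 < kappa).
Hypothesis flow : winfree_flow m kappa nu theta v dv.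

Local Notation Rp := (order_parameter theta).

Lemma order_parameter_ge (c : R) t : (forall j, c <= 1 + cos (theta j t)) -> c <= Rp t.
Proof.
move=> cth; have n0 : (0 : R) < N%:R by rewrite ltr0n.
rewrite /order_parameter mulrC ler_pdivlMr//.
rewrite mulr_natr -[X in _ *+ X]card_ord -sumr_const.
by apply: ler_sum => j _.
Qed.

Lemma order_parameter_ge0 t : 0 <= Rp t.
Proof. by apply: order_parameter_ge => j; have := cos_geN1 (theta j t); lra. Qed.

Lemma order_parameter_le2 t : Rp t <= 2.
Proof.
have n0 : (0 : R) < N%:R by rewrite ltr0n.
rewrite /order_parameter mulrC ler_pdivrMr//.
rewrite mulr_natr -[X in _ *+ X]card_ord -sumr_const.
by apply: ler_sum => j _; have := cos_le1 (theta j t); lra.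
Qed.

(** The forcing is less than [kappa + 2 * kappa] in absolute value, because the order parameter is
    at most 2. When [|v i|] equals [3 * kappa], friction therefore dominates and the speed
    decreases. *)
Lemma velocity_bound t0 : 0 < t0 -> (forall i, `|nu i| < kappa) ->
  (forall i, `|v i t0| < 3 * kappa) ->
  forall i t, t0 <= t -> `|v i t| < 3 * kappa.
Proof.
move=> t00 nuk vt0.
apply: (@barrier_norm R 'I_N v dv) => // [|i t tt0|i t tt0 _ vB].
- by rewrite mulr_ge0// ltW.
- by have [] := flow i (lt_le_trans t00 tt0).
have [_ _] := flow i (lt_le_trans t00 tt0).
set f := nu i - _ => fE.
have fB : `|f| < 3 * kappa.
  rewrite /f (le_lt_trans (ler_normB _ _))// 2!normrM (gtr0_norm kappa0).
  rewrite (ger0_norm (order_parameter_ge0 t)).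
  have : Rp t * `|sin (theta i t)| <= 2 * 1.
    by rewrite ler_pM ?order_parameter_ge0 ?order_parameter_le2 ?sin_max.
  rewrite -(ler_pM2l kappa0) mulrA => le2; have := nuk i; lra.
have vv : v i t * v i t = (3 * kappa) ^+ 2 by rewrite -vB real_normK ?num_real// expr2.
have : v i t * f < (3 * kappa) ^+ 2.
  apply: le_lt_trans (ler_norm _) _; rewrite normrM vB expr2 ltr_pM2l// mulr_gt0//.
rewrite -fE mulrDr vv => vdv; rewrite -(pmulr_rlt0 _ m0); lra.
Qed.

Local Notation phi := (phase m theta v).
Let p i t := nu i - kappa * Rp t * sin (theta i t).

Lemma is_derive_phase i t : 0 < t -> is_derive t 1 (phi i) (p i t).
Proof.
move=> t0; have [dth dvv e] := flow i t0.
rewrite /p -e /phase; apply: is_derive_eq; rewrite addrC; congr (_ + _).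
Qed.

Lemma phase_dist i t : `|v i t| < 3 * kappa -> `|theta i t - phi i t| <= 3 * (m * kappa).
Proof.
move=> vB; rewrite /phase opprD addNKr normrN normrM (gtr0_norm m0) mulrCA.
by rewrite ler_wpM2l// ltW.
Qed.

(* The window [lo, hi] for |theta_i| is shrunk by e on both sides to give a
   window for |phi_i|, since |phi_i - theta_i| <= e. *)
Lemma phase_small (t0 lo hi e s r : R) : 0 < t0 -> 0 < lo -> 0 <= s -> 0 <= r ->
  (forall x, lo <= x <= hi -> s <= sin x) ->
  (forall x, `|x| <= hi -> r <= 1 + cos x) ->
  3 * (m * kappa) <= e -> lo + e < hi - e ->
  (forall i, `|nu i| < kappa * (r * s)) ->
  (forall i t, t0 <= t -> `|v i t| < 3 * kappa) ->
  (forall i, `|phi i t0| < hi - e) ->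
  exists2 T, t0 <= T & forall i t, T <= t -> `|phi i t| < lo + e.
Proof.
move=> t00 lo0 s0 r0 sins cosr mke lohi nus vB phi0.
have e0 : 0 <= e by rewrite (le_trans _ mke)// !mulr_ge0// ltW.
have phid i t : t0 <= t -> is_derive t 1 (phi i) (p i t).
  by move=> tt0; apply/is_derive_phase/(lt_le_trans t00).
have dist i t : t0 <= t -> `|theta i t - phi i t| <= e.
  by move=> tt0; rewrite (le_trans (phase_dist (vB _ _ tt0))).
(* While all phases stay in the cube, every angle is within [hi], so the order parameter is at least
   [r]; the pull towards 0 then has strength at least [kappa * (r * s)]. *)
have drift i t : t0 <= t -> (forall j, `|phi j t| <= hi - e) ->
    lo + e <= `|phi i t| ->
    phi i t * p i t <= `|phi i t| * (`|nu i| - kappa * (r * s)).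
  move=> tt0 phiB lophi.
  have rR : r <= Rp t.
    apply: order_parameter_ge => j; apply: cosr.
    have := dist j t tt0; have := phiB j.
    have := ler_normD (theta j t - phi j t) (phi j t); rewrite subrK; lra.
  have : `|phi i t| * s <= phi i t * sin (theta i t).
    apply: (mul_sin_ge (ltW lo0) e0 sins); last exact: dist.
    by rewrite lophi phiB.
  have : phi i t * nu i <= `|phi i t| * `|nu i| by rewrite -normrM ler_norm.
  rewrite /p => le1 le2.
  have : r * (`|phi i t| * s) <= Rp t * (phi i t * sin (theta i t)).
    by rewrite ler_pM// mulr_ge0.
  rewrite -(ler_pM2l kappa0); lra.
have driftneg i t : t0 <= t -> (forall j, `|phi j t| <= hi - e) ->
    lo + e <= `|phi i t| ->
    phi i t * p i t <= - ((lo + e) * (kappa * (r * s) - `|nu i|)).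
  move=> tt0 phiB lophi; have := drift _ _ tt0 phiB lophi.
  have : 0 <= (`|phi i t| - (lo + e)) * (kappa * (r * s) - `|nu i|).
    by rewrite mulr_ge0 ?subr_ge0// ltW.
  lra.
have pos i : 0 < (lo + e) * (kappa * (r * s) - `|nu i|).
  by rewrite mulr_gt0 ?subr_gt0// ltr_pwDl.
have trap i t : t0 <= t -> `|phi i t| < hi - e.
  apply: (@barrier_norm R 'I_N phi p) => // [|j u tu phiB phiE].
    by rewrite (le_trans _ (ltW lohi))// addr_ge0// ltW.
  have := driftneg j u tu phiB; rewrite phiE => /(_ (ltW lohi)).
  by have := pos j; lra.
(* The squared phase decreases at a uniform rate while [|phi i|] is at least [lo + e], so it gets
   below that level. A barrier indexed by [unit] then holds this one phase there, since each
   oscillator enters at its own time; [trap] controls the others. *)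
have ev i : \forall t \near +oo, `|phi i t| < lo + e.
  have [|||T t0T phiT] := @decay_below R (phi i ^+ 2) (fun t => 2 * (phi i t * p i t)) t0
      ((lo + e) ^+ 2) (2 * ((lo + e) * (kappa * (r * s) - `|nu i|))).
  - by rewrite mulr_gt0.
  - by move=> t tt0; exact: is_derive_sqr (phid i t tt0).
  - move=> t tt0 phige; rewrite -mulrN ler_pM2l//; apply: driftneg => //.
      by move=> j; exact/ltW/trap.
    rewrite -(ler_pXn2r (n := 2)) ?nnegrE// ?real_normK ?num_real//.
    by rewrite addr_ge0// ltW.
  exists T; split; first exact: num_real.
  move=> t /= /ltW Tt.
  apply: (@barrier_norm R unit (fun=> phi i) (fun=> p i) T _ _ _ _ _ tt) => //.
  - by rewrite addr_ge0// ltW.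
  - by move=> _ u Tu; apply: phid; exact: le_trans Tu.
  - move=> _; rewrite -(ltr_pXn2r (n := 2)) ?nnegrE//; last by rewrite addr_ge0// ltW.
    by rewrite real_normK ?num_real//; exact: phiT.
  - move=> _ u Tu _ phiE; have t0u := le_trans t0T Tu.
    apply: le_lt_trans (driftneg i u t0u _ _) _; last by rewrite oppr_lt0.
      by move=> j; exact/ltW/trap.
    by rewrite phiE.
have [M [_ HM]] := filter_forall _ ev.
(* The shift by 1 is there because [HM] holds only strictly beyond [M]. *)
exists (Num.max t0 (M + 1)); first by rewrite le_max lexx.
move=> i t; rewrite ge_max => /andP[_ Mt]; apply: HM.
by rewrite /= (lt_le_trans _ Mt)// ltrDl.
Qed.

(** The matrix [H] has entries [kappa * (Rp * cos (theta i))] on the diagonal, minus the rank-one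
    part [kappa / N * sin (theta i) * sin (theta j)]. The cosine threshold makes it positive
    definite, and small [m * kappa] lets damping absorb the [q] terms. *)
Lemma velocity_decay (T : R) : 0 < T -> 3 * (m * kappa) <= 1 ->
  (forall i t, T <= t -> 9 / 10 <= cos (theta i t)) ->
  exists C, forall i t, T <= t -> `|v i t| <= C * expR (- (kappa * t)).
Proof.
move=> T0 mk cosT.
have n0 : (0 : R) < N%:R by rewrite ltr0n.
pose S t := \sum_j sin (theta j t) * v j t.
have dR t : 0 < t -> is_derive t 1 Rp (- (N%:R^-1 * S t)).
  move=> t0.
  have -> : Rp = N%:R^-1 *: (\sum_(j < N) (cst 1 + cos \o theta j)).
    by apply/funext => u; rewrite /order_parameter fctE/= fct_sumE.
  have dth j : is_derive t 1 (theta j) (v j t) by have [] := flow j t0.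
  apply: is_derive_eq; rewrite -mulrN /S -sumrN; congr (_ * _).
  by apply: eq_bigr => j _; rewrite add0r mulNr.
pose dp i t := kappa * (N%:R^-1 * S t * sin (theta i t) - Rp t * cos (theta i t) * v i t).
have dpE i t : 0 < t -> is_derive t 1 (p i) (dp i t).
  move=> t0; have dRt := dR t t0; have [dth _ _] := flow i t0.
  have -> : p i = cst (nu i) - kappa *: (Rp * (sin \o theta i)).
    by apply/funext => u; rewrite /p !fctE/= -mulrA.
  apply: is_derive_eq; rewrite -![_ *: _]/(_ * _) /dp /=; ring.
pose q i t := p i t - v i t.
have qE i t : 0 < t -> q i t = m * dv i t.
  by move=> t0; have [_ _ e] := flow i t0; rewrite /q /p -e addrK.
pose E t := \sum_i (p i t ^+ 2 + q i t ^+ 2).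
pose dE t := \sum_i (2 * (p i t * dp i t) + 2 * (q i t * (dp i t - dv i t))).
have dEE t : 0 < t -> is_derive t 1 E (dE t).
  move=> t0.
  have -> : E = \sum_(i < N) (p i ^+ 2 + (p i - v i) ^+ 2).
    by apply/funext => u; rewrite /E fct_sumE.
  have dpt i : is_derive t 1 (p i) (dp i t) by exact: dpE.
  have dvt i : is_derive t 1 (v i) (dv i t) by have [] := flow i t0.
  exact: is_derive_sum (fun i => is_deriveD (is_derive_sqr (dpt i))
    (is_derive_sqr (is_deriveB (dpt i) (dvt i)))).
(* The left side is [- pHp + qHq]; the bounds [kappa <= H <= 2 * kappa] give the right side. *)
have drift t : T <= t ->
    \sum_i (p i t + q i t) * dp i t <= kappa * \sum_i (2 * q i t ^+ 2 - p i t ^+ 2).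
  move=> Tt.
  have -> : \sum_i (p i t + q i t) * dp i t =
      kappa * (N%:R^-1 * (S t * \sum_i sin (theta i t) * (p i t + q i t)) -
        \sum_i Rp t * cos (theta i t) * (p i t ^+ 2 - q i t ^+ 2)).
    rewrite mulrBr !mulr_sumr -sumrB; apply: eq_bigr => i _.
    rewrite /dp /q; ring.
  rewrite ler_pM2l//.
  set A := \sum_i sin (theta i t) * p i t.
  set B := \sum_i sin (theta i t) * q i t.
  have -> : S t = A - B.
    by rewrite /S /A /B -sumrB; apply: eq_bigr => i _; rewrite /q; ring.
  have -> : \sum_i sin (theta i t) * (p i t + q i t) = A + B.
    by rewrite /A /B -big_split/=; apply: eq_bigr => i _; rewrite mulrDr.
  (* The rank-one part contributes [A ^+ 2 - B ^+ 2]. The square of [B] has the favourable sign, and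
     Cauchy-Schwarz turns that of [A] into a diagonal term. *)
  have AB : N%:R^-1 * ((A - B) * (A + B)) <= \sum_i (sin (theta i t) * p i t) ^+ 2.
    rewrite mulrC ler_pdivrMr// [leRHS]mulrC; apply: le_trans (sqr_sum_le _); rewrite -/A.
    by have := sqr_ge0 B; lra.
  rewrite lerBlDr; apply: (le_trans AB); rewrite -big_split/=.
  apply: ler_sum => i _.
  have c9 := cosT i t Tt; have c1 := cos_le1 (theta i t).
  have R2 := order_parameter_le2 t.
  have R19 : 19 / 10 <= Rp t.
    by apply: order_parameter_ge => j; have := cosT j t Tt; lra.
  have s2 := cos2Dsin2 (theta i t).
  rewrite exprMn; move: (cos _) (sin _) (Rp t) c9 c1 R2 R19 s2 => c s r c9 c1 R2 R19 s2.
  (* Here [r * c] is at least 1.71 while [s ^+ 2] is at most 0.19. *)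
  have rc1 : 1 + s ^+ 2 <= r * c by nra.
  have rc2 : r * c <= 2 by nra.
  have := mulr_ge0 (sqr_ge0 (p i t)) (_ : 0 <= r * c - (1 + s ^+ 2)).
  have := mulr_ge0 (sqr_ge0 (q i t)) (_ : 0 <= 2 - r * c).
  rewrite !subr_ge0 => /(_ rc2) + /(_ rc1); lra.
have decay t : T <= t -> dE t <= - (2 * kappa) * E t.
  move=> Tt; have t0 := lt_le_trans T0 Tt.
  have dvq i : q i t * dv i t = m^-1 * q i t ^+ 2.
    by rewrite qE//; field; rewrite gt_eqF.
  have -> : dE t = 2 * (\sum_i (p i t + q i t) * dp i t - m^-1 * \sum_i q i t ^+ 2).
    rewrite /dE mulr_sumr -sumrB mulr_sumr; apply: eq_bigr => i _.
    by rewrite -dvq; ring.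
  (* The [q] part of [dE] is then at most [4 * kappa - 6 * kappa = - 2 * kappa] times the sum of the
     squares of the [q i], the same rate as for [p]. *)
  have minv : 3 * kappa <= m^-1.
    by rewrite -(ler_pM2l m0) mulfV ?gt_eqF//; lra.
  have Q0 : 0 <= \sum_i q i t ^+ 2 by apply: sumr_ge0 => i _; exact: sqr_ge0.
  have := drift t Tt; rewrite sumrB -mulr_sumr /E big_split/=.
  have := ler_wpM2r Q0 minv; lra.
pose F t := E t * expR (2 * kappa * t).
have F_le t : T <= t -> F t <= F T.
  move=> Tt; apply: (@is_derive_le0_decr R F (fun u =>
    expR (2 * kappa * u) * (dE u + 2 * kappa * E u)) T) => // u Tu.
    have dEu := dEE u (lt_le_trans T0 Tu).
    apply: is_derive_eq; rewrite -![_ *: _]/(_ * _) /=; ring.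
  by rewrite pmulr_rle0 ?expR_gt0//; have := decay u Tu; lra.
(* The square of [v i] is at most [2 * F T] times the squared exponential, and
   [2 * x <= (x + 1) ^+ 2] avoids a square root. *)
exists (F T + 1) => i t Tt.
have E_ge : v i t ^+ 2 <= 2 * E t.
  have : p i t ^+ 2 + q i t ^+ 2 <= E t.
    rewrite /E (bigD1 i)//= lerDl; apply: sumr_ge0 => j _.
    by rewrite addr_ge0 ?sqr_ge0.
  have -> : v i t = p i t - q i t by rewrite /q; ring.
  by have := sqr_ge0 (p i t + q i t); lra.
have F0 : 0 <= F T.
  rewrite mulr_ge0 ?expR_ge0//; apply: sumr_ge0 => j _.
  by rewrite addr_ge0 ?sqr_ge0.
rewrite -(ler_pXn2r (n := 2)) ?nnegrE ?mulr_ge0 ?expR_ge0 ?addr_ge0// real_normK ?num_real//.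
rewrite exprMn; have -> : (F T + 1) ^+ 2 = F T ^+ 2 + 2 * F T + 1 by ring.
have EF : E t = F t * expR (- (kappa * t)) ^+ 2.
  by rewrite /F -mulrA expr2 -!expRD (_ : _ + _ = 0) ?expR0 ?mulr1//; ring.
apply: (le_trans E_ge); rewrite EF mulrA ler_wpM2r ?sqr_ge0//.
by have := F_le t Tt; have := sqr_ge0 (F T); lra.
Qed.

End flow.

(** * From solutions of the Cauchy problem to oscillator death *)

Lemma le_max_abs (R : realType) (N : nat) (x : 'I_N -> R) i : `|x i| <= max_abs x.
Proof. exact: le_bigmax. Qed.

Lemma max_abs_ge0 (R : realType) (N : nat) (x : 'I_N -> R) : 0 <= max_abs x.
Proof. exact: bigmax_ge_id. Qed.

Lemma max_abs_lt (R : realType) (N : nat) (x : 'I_N -> R) B :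
  0 < B -> (forall i, `|x i| < B) -> max_abs x < B.
Proof. by move=> B0 xB; rewrite /max_abs; apply/bigmax_ltP; split. Qed.

(* Provides a positive starting time, so that the one-sided regularity at 0 is
   not needed afterwards. *)
Lemma winfree_solution_near0 (R : realType) (N : nat) (m kappa : R)
    (nu theta0 omega0 : 'I_N -> R) (theta : 'I_N -> R -> R) (A W : R) :
  winfree_solution m kappa nu theta0 omega0 theta ->
  (forall i, `|theta0 i| < A) -> (forall i, `|omega0 i| < W) ->
  exists2 t, 0 < t & forall i, `|theta i t| < A /\ `|(theta i)^`() t| < W.
Proof.
move=> sol thA omW.
have theta_near i : \forall t \near (0 : R)^'+, `|theta i t| < A.
  have [th0 dth _ _] := sol i.
  (* Right continuity of the angle at 0 is recovered from its difference quotient, multiplied by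
     [h]. *)
  have : (h * (h^-1 * (theta i h - theta i 0)) + theta i 0) @[h --> (0 : R)^'+] -->
      0 * omega0 i + theta i 0.
    apply: cvgD; last exact: cvg_cst.
    apply: cvgM => //; apply: cvg_at_right_filter; exact: cvg_id.
  rewrite mul0r add0r th0 => cvth.
  have : theta i h @[h --> (0 : R)^'+] --> theta0 i.
    apply: cvg_trans cvth; apply: near_eq_cvg; near=> h.
    by rewrite mulrA mulfV ?mul1r ?subrK// gt_eqF//; near: h; exact: nbhs_right_gt.
  by move=> /cvg_norm /cvgr_lt; apply.
have velocity_near i : \forall t \near (0 : R)^'+, `|(theta i)^`() t| < W.
  by have [_ _ + _] := sol i; move=> /cvg_norm /cvgr_lt; apply.
have both := filter_forall _ (fun i => filterI (theta_near i) (velocity_near i)).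
by have [t [t0 H]] := filter_ex (filterI (nbhs_right_gt (0 : R)) (both _ _)); exists t.
Unshelve. all: by end_near. Qed.

Lemma cvg_order_parameter (R : realType) (N : nat) (theta : 'I_N -> R -> R)
    (l : 'I_N -> R) :
  (forall i, theta i t @[t --> +oo] --> l i) ->
  order_parameter theta t @[t --> +oo] --> N%:R^-1 * \sum_(j < N) (1 + cos (l j)).
Proof.
move=> thl; apply: cvgM; first exact: cvg_cst.
apply: cvg_big => [|j _]; [exact: add_continuous|]; apply: cvgD; first exact: cvg_cst.
by apply: continuous_cvg; [exact: continuous_cos|exact: thl].
Qed.

(** The constants are produced before [N] and the initial data are introduced, which gives the
    required uniformity. *)
Lemma winfree_death_constants (R : realType) (M eps : R) :
  0 <= M < pi -> 0 < eps ->
  exists abc : R * R * R,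
    [/\ 0 < abc.1.1, 0 < abc.1.2 & 0 < abc.2] /\
    forall (N : nat) (theta0 omega0 nu : 'I_N -> R) (kappa m : R)
        (theta : 'I_N -> R -> R),
      (0 < N)%N -> (forall i, `|theta0 i| <= M) -> 0 < kappa -> 0 < m ->
      max_abs nu / kappa < abc.1.1 -> m * kappa < abc.1.2 ->
      max_abs omega0 / kappa < abc.2 ->
      winfree_solution m kappa nu theta0 omega0 theta ->
      oscillator_death theta /\
      exists2 Rinf : R,
        order_parameter theta t @[t --> +oo] --> Rinf & 2 - eps < Rinf.
Proof.
move=> /andP[M0 Mpi] eps0.
(* The phases are trapped in |phi| < pi - d - delta, where |theta| <= pi - d,
   and then enter |phi| < 2 delta, where |theta| <= 3 delta <= delta1. *)
pose d := (pi - M) / 4.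
have d0 : 0 < d by rewrite divr_gt0// subr_gt0.
have dM : pi = M + 4 * d by rewrite /d; field.
(* The first bound yields [2 - eta > 2 - eps] in the limit, the second the cosine threshold 9/10 of
   [velocity_decay]. *)
pose eta : R := Num.min (eps / 2) (1 / 10).
have eta0 : 0 < eta by rewrite lt_min !divr_gt0.
have [delta1 delta10 cos1] := cos_near0 eta0.
pose delta := Num.min (d / 2) (delta1 / 3).
have delta0 : 0 < delta by rewrite lt_min (divr_gt0 d0)// divr_gt0.
have delta_d : delta <= d / 2 by rewrite ge_min lexx.
have delta_1 : 3 * delta <= delta1.
  have : delta <= delta1 / 3 by rewrite ge_min lexx orbT.
  lra.
have [//|||s s0 sins] := @sin_itv_lower_bound R delta (pi - d); [lra|lra|].
have [|r r0 cosr] := @cos_lower_bound R (pi - d); first lra.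
(* For [nu], 1 serves the velocity bound and [r * s] the inward drift. For [m * kappa], [delta / 3]
   makes the phase shift at most [delta] and [1 / 3] serves the exponential decay. The initial
   speeds must lie below [3 * kappa]. *)
exists (Num.min 1 (r * s), Num.min (delta / 3) (1 / 3), 3) => /=.
split; first by rewrite !lt_min ltr01 mulr_gt0// (divr_gt0 delta0)// divr_gt0.
move=> N theta0 omega0 nu kappa m theta N0 th0 kappa0 m0.
rewrite !lt_min !ltr_pdivrMr// => /andP[nu1 nurs] /andP[mk1 mk2] om3 sol.
pose v i := (theta i)^`().
have flow : winfree_flow m kappa nu theta v _ := winfree_solution_flow sol.
have [i|i|t0 t00 init] := @winfree_solution_near0 _ _ _ _ _ _ _ _ (M + d) (3 * kappa) sol.
- by rewrite (le_lt_trans (th0 i))// ltrDl.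
- exact: le_lt_trans (le_max_abs _ _) om3.
have vB := velocity_bound N0 m0 kappa0 flow t00.
have {}vB : forall i t, t0 <= t -> `|v i t| < 3 * kappa.
  apply: vB => i; last by have [] := init i.
  by rewrite (le_lt_trans (le_max_abs _ _))// -[ltRHS]mul1r.
have mkd : 3 * (m * kappa) <= delta by lra.
have dist i t : t0 <= t -> `|theta i t - phase m theta v i t| <= delta.
  move=> tt0; apply: le_trans mkd; apply: phase_dist => //; exact: vB.
have [|i||i|T t0T small] :=
  phase_small N0 m0 kappa0 flow t00 delta0 (ltW s0) (ltW r0) sins cosr mkd.
- lra.
- by rewrite (le_lt_trans (le_max_abs _ _))// mulrC.
- exact: vB.
- have [thi _] := init i; have := dist i t0 (lexx _).
  have := ler_distD (theta i t0) (phase m theta v i t0) 0.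
  rewrite !subr0 distrC; lra.
have T0 : 0 < T by exact: lt_le_trans t0T.
have cosT i t : T <= t -> 1 - eta <= cos (theta i t).
  move=> Tt; apply: cos1; have := small i t Tt; have := dist i t (le_trans t0T Tt).
  have := ler_distD (phase m theta v i t) (theta i t) 0.
  rewrite !subr0; lra.
have eta1 : eta <= 1 / 10 by rewrite ge_min lexx orbT.
have eta2 : eta <= eps / 2 by rewrite ge_min lexx.
have [||C vC] := velocity_decay N0 m0 kappa0 flow T0; first by lra.
  by move=> i t Tt; have := cosT i t Tt; lra.
have lim i := cvg_of_expR_derive kappa0
  (fun t Tt => let: And3 h _ _ := flow i t (lt_le_trans T0 Tt) in h) (vC i).
split=> //.
have /choice[l thl] : forall i, exists l : R, theta i t @[t --> +oo] --> l.
  by move=> i; have [] := lim i.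
exists (N%:R^-1 * \sum_(j < N) (1 + cos (l j))); first exact: cvg_order_parameter.
have : 2 - eta <= N%:R^-1 * \sum_(j < N) (1 + cos (l j)).
  apply: cvgr_to_ge (cvg_order_parameter thl) _.
  near=> t; apply: order_parameter_ge => // j.
  have Tt : T <= t by near: t; apply: nbhs_pinfty_ge; rewrite num_real.
  by have := cosT j t Tt; lra.
lra.
Unshelve. all: by end_near. Qed.

Theorem theorem1p3 (R : realType) :
  exists a b c : R -> R -> R,
    forall (N : nat) (theta0 : 'I_N -> R) (eps : R),
      (0 < N)%N ->
      (forall i : 'I_N, - pi < theta0 i < pi) ->
      0 < eps ->
      let M := max_abs theta0 in
      [/\ 0 < a M eps, 0 < b M eps & 0 < c M eps] /\
      forall (omega0 nu : 'I_N -> R) (kappa m : R) (theta : 'I_N -> R -> R),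
        0 < kappa ->
        0 < m ->
        max_abs nu / kappa < a M eps ->
        m * kappa < b M eps ->
        max_abs omega0 / kappa < c M eps ->
        winfree_solution m kappa nu theta0 omega0 theta ->
        oscillator_death theta /\
        exists2 Rinf : R,
          order_parameter theta t @[t --> +oo] --> Rinf & 2 - eps < Rinf.
Proof.
(* Choice over all pairs [(M, eps)] makes the constants functions of these two numbers alone.
   Outside the admissible range [good] holds vacuously, whence the default [(0, 0, 0)]. *)
pose good (Me : R * R) (abc : R * R * R) := 0 <= Me.1 < pi -> 0 < Me.2 ->
  [/\ 0 < abc.1.1, 0 < abc.1.2 & 0 < abc.2] /\
  forall (N : nat) (theta0 omega0 nu : 'I_N -> R) (kappa m : R)
      (theta : 'I_N -> R -> R),
    (0 < N)%N -> (forall i, `|theta0 i| <= Me.1) -> 0 < kappa -> 0 < m ->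
    max_abs nu / kappa < abc.1.1 -> m * kappa < abc.1.2 ->
    max_abs omega0 / kappa < abc.2 ->
    winfree_solution m kappa nu theta0 omega0 theta ->
    oscillator_death theta /\
    exists2 Rinf : R,
      order_parameter theta t @[t --> +oo] --> Rinf & 2 - Me.2 < Rinf.
have /choice[abc abcP] : forall Me, exists abc, good Me abc.
  move=> [M eps].
  have [Mpi|Mpi] := boolP (0 <= M < pi); last by exists (0, 0, 0) => /(negP Mpi).
  have [eps0|eps0] := boolP (0 < eps); last by exists (0, 0, 0) => _ /(negP eps0).
  by have [abc abcP] := winfree_death_constants Mpi eps0; exists abc.
exists (fun M eps => (abc (M, eps)).1.1), (fun M eps => (abc (M, eps)).1.2),
  (fun M eps => (abc (M, eps)).2) => N theta0 eps N0 th0 eps0 M.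
have MI : 0 <= M < pi.
  rewrite max_abs_ge0 max_abs_lt ?pi_gt0// => i; rewrite ltr_norml; exact: th0.
have [pos death] := abcP (M, eps) MI eps0; split=> // omega0 nu kappa m theta.
by move=> k0 m0 nua mb omc sol; apply: death sol => // i; exact: le_max_abs.
Qed.
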